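(* Let $G=(V,E)$ be a finite, simple, connected undirected graph in which every edge carries exactly one label from a finite label set $L$, and let $H_i$ be a hedge of $G$. Then $$\delta_L(V(G))-1\leq \delta_L(V(G/H_i)).$$
   Context: For each label $\ell_i$, the hedge $H_i$ is the set of edges carrying label $\ell_i$. $G/H_i$ is the graph obtained from $G$ in the following steps: 1. Contract every edge of $H_i$, so each connected component of the subgraph formed by $H_i$ becomes a single vertex. 2. Delete the resulting loops with label $\ell_i$. Loops with other labels created by the contraction are kept. 3. Clean up: parallel edges with the same label between two vertices are merged into one, and loops with the same label at a vertex are merged into one. All remaining edges keep their labels. The label degree $d_L(v)$ of a vertex $v$ in a graph (in $G$ or in $G/H_i$) is the number of distinct labels on edges, including loops, incident with $v$. $\delta_L(V(\cdot))$ denotes the minimum label degree over all vertices of the respective graph. *)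

(* Defs.v *)
From HB Require Import structures.
From mathcomp Require Import all_boot all_order all_algebra.

Set Implicit Arguments.
Unset Strict Implicit.
Unset Printing Implicit Defensive.

(* Finite undirected multigraphs, loops allowed, with one label on each edge.
   [ends e] is the set of endpoints of [e]: a singleton exactly when [e] is a
   loop. *)
Record lgraph (L : finType) := LGraph {
  vert : finType;
  edge : finType;
  ends : edge -> {set vert};
  lab : edge -> L;
  card_ends : forall e, 0 < #|ends e| <= 2
}.

Section LabelledGraphs.
Variable L : finType.
Implicit Types (G : lgraph L) (l : L).

Definition is_loop G (e : edge G) : bool := #|ends e| == 1.

Definition simple_graph G : Prop :=
  (forall e : edge G, ~~ is_loop e) /\ injective (@ends L G).

(* Adjacency through an edge belonging to [F]. *)
Definition adj G (F : {set edge G}) : rel (vert G) :=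
  fun x y => [exists e in F, ends e == [set x; y]].

Definition connected_graph G : Prop :=
  0 < #|vert G| /\ forall x y : vert G, connect (adj [set: edge G]) x y.

Definition hedge G l : {set edge G} := [set e | lab e == l].

(* Components of the spanning subgraph with edge set [F]; a vertex not covered
   by [F] is a component by itself. *)
Definition component G (F : {set edge G}) (x : vert G) : {set vert G} :=
  [set y | connect (adj F) x y].

Definition components G (F : {set edge G}) : {set {set vert G}} :=
  [set component F x | x in [set: vert G]].

Definition contract_vert G (F : {set edge G}) : finType :=
  {C : {set vert G} | C \in components F}.

Lemma component_in G (F : {set edge G}) (x : vert G) :
  component F x \in components F.
Proof. exact: imset_f. Qed.

Definition contract_proj G (F : {set edge G}) (x : vert G) :
  contract_vert F := exist _ (component F x) (component_in F x).

Definition contract_ends G (F : {set edge G}) (e : edge G) :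
  {set contract_vert F} := [set contract_proj F x | x in ends e].

Lemma card_contract_ends G (F : {set edge G}) (e : edge G) :
  0 < #|contract_ends F e| <= 2.
Proof.
have /andP[e_gt0 e_le2] := card_ends e.
rewrite (leq_trans (leq_imset_card _ _) e_le2) andbT.
by have /card_gt0P[x xe] := e_gt0; apply/card_gt0P;
  exists (contract_proj F x); apply: imset_f.
Qed.

(* All edges survive here: those of [F] have become loops. *)
Definition contract G (F : {set edge G}) : lgraph L :=
  {| vert := contract_vert F; edge := edge G; ends := contract_ends F;
     lab := @lab L G; card_ends := card_contract_ends F |}.

Definition del_loops G l : lgraph L :=
  {| vert := vert G;
     edge := {e : edge G | ~~ (is_loop e && (lab e == l))} : finType;
     ends := fun e => ends (val e);
     lab := fun e => lab (val e);
     card_ends := fun e => card_ends (val e) |}.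

(* An edge of the merged graph is a pair (endpoints, label) carried by some
   edge of [G]; for loops the set of endpoints is a singleton. *)
Definition merge_keys G : {set {set vert G} * L} :=
  [set (ends e, lab e) | e in [set: edge G]].

Lemma card_merge_ends G (p : {p | p \in merge_keys G}) :
  0 < #|(val p).1| <= 2.
Proof. by case: p => p /= /imsetP[e _ ->]; apply: card_ends. Qed.

Definition merge_parallel G : lgraph L :=
  {| vert := vert G;
     edge := {p | p \in merge_keys G} : finType;
     ends := fun p => (val p).1;
     lab := fun p => (val p).2;
     card_ends := @card_merge_ends G |}.

(* The graph G/H, for H the hedge of label [l]. *)
Definition contract_hedge G l : lgraph L :=
  merge_parallel (del_loops (contract (hedge G l)) l).

Definition label_degree G (v : vert G) : nat :=
  #|[set lab e | e in [set e : edge G | v \in ends e]]|.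

(* Label degrees are at most #|L|, so the default value #|L| does not affect
   the minimum of a nonempty graph. *)
Definition min_label_degree G : nat :=
  \big[minn/#|L|]_(v : vert G) label_degree v.

End LabelledGraphs.

(* Main.v *)
Require Import Defs.
From HB Require Import structures.
From mathcomp Require Import all_boot all_order all_algebra.

(** A vertex of [G/H] is the component of some vertex [x] of [G]. An edge at [x]
    with a label other than [l] keeps its label and stays incident with that
    component, so passing from [x] to its component loses at most the label [l]. *)

Lemma min_label_degree_le (L : finType) (G : lgraph L) (v : vert G) :
  min_label_degree G <= label_degree v.
Proof.
rewrite /min_label_degree; elim: (index_enum _) (mem_index_enum v) => // w s IHs.
rewrite inE big_cons => /orP[/eqP <-|/IHs vs]; first exact: geq_minl.
exact: leq_trans (geq_minr _ _) vs.
Qed.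

(** The bound [k <= #|L|] covers the default value of the iterated minimum. *)
Lemma min_label_degree_ge (L : finType) (G : lgraph L) (k : nat) :
    k <= #|L| -> (forall v : vert G, k <= label_degree v) ->
  k <= min_label_degree G.
Proof.
move=> kL kdeg; apply: (big_ind (fun m => k <= m)) => // m n km kn.
by rewrite leq_min km kn.
Qed.

Lemma min_label_degree_le_card (L : finType) (G : lgraph L) :
  min_label_degree G <= #|L|.
Proof.
by apply: (big_rec (fun m => m <= #|L|)) => // v m _; apply: leq_trans (geq_minr _ _).
Qed.

Lemma label_degree_contract_hedge (L : finType) (G : lgraph L) (l : L)
    (x : vert G) :
  label_degree x <=
    (@label_degree L (contract_hedge G l) (contract_proj (hedge G l) x)).+1.
Proof.
(* Split off [l], which counts for at most one whether or not it occurs at [x]. *)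
rewrite /label_degree (cardsD1 l) -add1n leq_add ?leq_b1 //.
apply/subset_leq_card/subsetP => m; rewrite in_setD1 => /andP[ml /imsetP[e]].
rewrite inE => xe me.
(* Contraction may turn [e] into a loop, but only loops labelled [l] are deleted. *)
have e_kept : ~~ (@is_loop L (contract (hedge G l)) e && (lab e == l)).
  by rewrite -me (negPf ml) andbF.
pose f : edge (del_loops (contract (hedge G l)) l) := exist _ e e_kept.
have f_key : (ends f, lab f) \in merge_keys (del_loops (contract (hedge G l)) l).
  exact: imset_f.
(* The merged edge that absorbs [e]; merging preserves endpoints and label. *)
pose g : edge (contract_hedge G l) := exist (fun p => p \in merge_keys _) _ f_key.
apply/imsetP; exists g => //; rewrite inE.
exact: imset_f.
Qed.

Theorem theorem11 (L : finType) (G : lgraph L) (l : L)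
    (simpleG : simple_graph G) (connG : connected_graph G) :
  ((min_label_degree G)%:Z - 1 <= (min_label_degree (contract_hedge G l))%:Z)%R.
Proof.
(* Pass to truncated subtraction on naturals, so that the left side is a lower bound [k] to test at
   each vertex. *)
rewrite Num.Theory.lerBlDr -PoszD lez_nat addn1 -add1n -leq_subLR.
apply: min_label_degree_ge => [|[C C_comp]].
  exact: leq_trans (leq_subr _ _) (min_label_degree_le_card _ _).
have /imsetP[x _ Cx] := C_comp.
have -> : exist _ C C_comp = contract_proj (hedge G l) x by apply: val_inj.
rewrite leq_subLR add1n.
exact: leq_trans (min_label_degree_le _ _ _) (label_degree_contract_hedge _ _ _ _).
Qed.
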